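(* Let $n\ge 3$. The expectation of the number of separators in a permutation chosen uniformly at random from $S_n$ is $$\frac{4(n^3-6n^2+14n-13)}{n(n-1)(n-2)}.$$ Consequently, this expectation tends to $4$ as $n\to\infty$.
   Context: Permutations $\pi\in S_n$ are written in one-line notation $\pi=[\pi_1,\dots,\pi_n]$. The digit $\pi_i$ is a vertical separator of $\pi$ if $1<i<n$ and $|\pi_{i-1}-\pi_{i+1}|=1$. The digit $\pi_i=a$ is a horizontal separator of $\pi$ if $1<a<n$ and the values $a-1$ and $a+1$ occupy adjacent positions in $\pi$, i.e. $|\pi^{-1}(a-1)-\pi^{-1}(a+1)|=1$. A digit is a separator of $\pi$ if it is a vertical separator or a horizontal separator (or both); a digit that is of both types is counted once in the number of separators. *)

(* Defs.v *)
From mathcomp Require Import all_boot all_order all_algebra all_fingroup.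

Set Implicit Arguments.
Unset Strict Implicit.
Unset Printing Implicit Defensive.

Import GRing.Theory.
Local Open Scope ring_scope.

(* Positions and digits range over 'I_n, i.e. over 0, ..., n-1 instead of
   1, ..., n: s i is the digit in position i and (s^-1)%g a is the position
   of the digit a.  A condition such as 1 < i < n is rendered by the existence
   of the two neighbours i-1 and i+1 in 'I_n. *)

Definition vertical_separator (n : nat) (s : 'S_n) (a : 'I_n) : bool :=
  let i := (s^-1)%g a in
  [exists j : 'I_n, exists k : 'I_n,
    [&& j.+1 == i :> nat, k == i.+1 :> nat & `|s j - s k|%N == 1%N]].

Definition horizontal_separator (n : nat) (s : 'S_n) (a : 'I_n) : bool :=
  [exists b : 'I_n, exists c : 'I_n,
    [&& b.+1 == a :> nat, c == a.+1 :> nat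
      & `|(s^-1)%g b - (s^-1)%g c|%N == 1%N]].

Definition separator (n : nat) (s : 'S_n) (a : 'I_n) : bool :=
  vertical_separator s a || horizontal_separator s a.

Definition nb_separators (n : nat) (s : 'S_n) : nat :=
  #|[set a : 'I_n | separator s a]|.

Definition uniform_expectation (R : fieldType) (T : finType) (X : T -> R) : R :=
  (\sum_(t : T) X t) / #|T|%:R.

Definition expected_separators (R : fieldType) (n : nat) : R :=
  uniform_expectation (fun s : 'S_n => (nb_separators s)%:R).

(* Main.v *)
(* By linearity, the total number of separators over S_n is V + H - B, where V, H
   and B count the pairs (s, a) with the digit a of s vertical, horizontal, or both.
   Inversion of permutations exchanges the two types, so V = H, and V is the sum
   over the n - 2 inner positions i of the 2 (n-1) (n-2)! permutations that take
   adjacent values at i - 1 and i + 1.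
   For B, fix the position i and the value a of the digit.  The values at i +- 1
   must be adjacent, and so must the positions of a +- 1.  Either the latter
   positions avoid i - 1 and i + 1, and five entries of s are prescribed; or exactly
   one entry is shared, and four entries are prescribed.  In either case the
   number of admissible prescriptions is a product of a factor depending on i and
   the same factor depending on a; summing over i and a gives
   B = (2 (n-3) (n-4))^2 (n-5)! + (2 (n-3))^2 (n-4)! = 4 (n-3)^2 (n-3)!. *)

Require Import Defs.
From mathcomp Require Import all_boot all_order all_algebra all_fingroup.
From mathcomp Require Import zify ring.

Set Implicit Arguments.
Unset Strict Implicit.
Unset Printing Implicit Defensive.

Import GRing.Theory Num.Theory.
Local Open Scope ring_scope.

(** * Permutations with prescribed entries *)

Lemma exists_perm_map (T : finType) (xs ys : seq T) :
  uniq xs -> uniq ys -> size xs = size ys ->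
  exists g : {perm T}, map g xs = ys.
Proof.
elim: xs ys => [|x xs IH] [|y ys] //=; first by exists 1%g.
case/andP=> xNs us /andP[yNs uys] [/(IH _ us uys)[g gE]].
(* Swapping [g x] and [y] after [g] repairs the head; neither value occurs in [ys], so the tail is
   unaffected. *)
exists (g * tperm (g x) y)%g; rewrite permM tpermL; congr cons.
rewrite -[RHS]gE; apply/eq_in_map => z zs; rewrite permM tpermD //.
  by rewrite (inj_eq perm_inj); apply: contraNneq xNs => ->.
by apply: contraNneq yNs => ->; rewrite -gE map_f.
Qed.

(** The solutions form a coset: dividing by one solution [g] leaves the permutations fixing [xs]
    pointwise, that is, those of its complement. *)
Lemma card_perm_map (T : finType) (xs ys : seq T) :
  uniq xs -> uniq ys -> size xs = size ys ->
  #|[set s : {perm T} | map s xs == ys]| = (#|T| - size xs)`!.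
Proof.
move=> uxs uys sz; have [g gE] := exists_perm_map uxs uys sz.
have -> : [set s : {perm T} | map s xs == ys] =
          [set (t * g)%g | t in perm_on [set x | x \notin xs]].
  apply/setP=> s; rewrite inE; apply/eqP/imsetP => [sE|[t tP ->]].
    exists (s * g^-1)%g; last by rewrite mulgKV.
    apply/subsetP => x; rewrite !inE permM; apply: contraNN => xs_x.
    apply/eqP/(@perm_inj _ g); rewrite permKV.
    by apply: (proj2 (eq_in_map s g xs)) => //; rewrite sE gE.
  rewrite -gE; apply/eq_in_map => x xs_x; rewrite permM.
  by rewrite (out_perm tP) // inE xs_x.
rewrite card_imset; last exact: mulIg.
rewrite card_perm; congr (_`!); rewrite -(card_uniqP uxs) -cardsE.
by rewrite cardsCs; congr (_ - _)%N; apply: eq_card => x; rewrite !inE negbK.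
Qed.

(** * Adjacency, inner positions and the shape of separators *)

Definition adj n (x y : 'I_n) : bool := (x.+1 == y :> nat) || (y.+1 == x :> nat).

Definition inner n (i : 'I_n) : bool := (0 < i)%N && (i.+1 < n)%N.

Lemma distn1_adj n (x y : 'I_n) : (`|x - y|%N == 1%N) = adj x y.
Proof. rewrite /adj; lia. Qed.

Lemma innerP n (i : 'I_n) :
  reflect (exists j k : 'I_n, j.+1 = i /\ i.+1 = k) (inner i).
Proof.
apply: (iffP andP) => [[i0 i1]|[j [k [ji ik]]]].
  have jn : (i.-1 < n)%N by lia.
  by exists (Ordinal jn), (Ordinal i1) => /=; lia.
by have := ltn_ord k; lia.
Qed.

Lemma vertical_separatorE n (s : 'S_n) (j i k : 'I_n) :
  j.+1 = i -> i.+1 = k -> vertical_separator s (s i) = adj (s j) (s k).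
Proof.
move=> ji ik; rewrite /vertical_separator permK.
apply/existsP/idP => [[j' /existsP[k' /and3P[/eqP jE /eqP kE]]]|sjk].
  have -> : j' = j by apply/val_inj; case: jE; rewrite -ji => -[].
  have -> : k' = k by apply/val_inj; rewrite /= kE.
  by rewrite distn1_adj.
by exists j; apply/existsP; exists k; rewrite ji ik !eqxx distn1_adj.
Qed.

Lemma vertical_separator_inner n (s : 'S_n) (i : 'I_n) :
  vertical_separator s (s i) -> inner i.
Proof.
rewrite /vertical_separator permK => /existsP[j /existsP[k /and3P[/eqP ji /eqP ik _]]].
by apply/innerP; exists j, k.
Qed.

Lemma horizontal_separatorV n (s : 'S_n) (a : 'I_n) :
  horizontal_separator s a = vertical_separator s^-1 (s^-1 a)%g.
Proof. by rewrite /vertical_separator permK. Qed.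

(** * Counting adjacent pairs relative to a position *)

Lemma sum_ord_eq (N k : nat) (P : pred nat) :
  (\sum_(q < N) ((k.+1 == q) && P q : nat) = ((k.+1 < N) && P k.+1 : nat))%N.
Proof.
case: ltnP => [kN|Nk] /=; last first.
  by rewrite big1 // => q _; have := ltn_ord q; case: eqP => //=; lia.
rewrite (bigD1 (Ordinal kN)) //= eqxx /= big1 ?addn0 // => q.
by rewrite -val_eqE /= eq_sym => /negPf ->.
Qed.

(** An adjacent pair is increasing or decreasing, never both. Taking [F] on naturals reduces later
    counts to arithmetic on the smaller entry [p]. *)
Lemma card_adj_pairs m (F : nat -> nat -> bool) :
  #|[set w : 'I_m.+1 * 'I_m.+1 | adj w.1 w.2 && F w.1 w.2]| =
  (\sum_(p < m) (F p p.+1 + F p.+1 p))%N.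
Proof.
have step (G : nat -> nat -> bool) :
    (\sum_(p < m.+1) \sum_(q < m.+1) ((p.+1 == q) && G p q : nat) =
     \sum_(p < m) G p p.+1)%N.
  under eq_bigr do rewrite (sum_ord_eq _ _ (G _)).
  rewrite big_ord_recr /= ltnn addn0; apply: eq_bigr => p _.
  by rewrite ltnS ltn_ord.
rewrite -sum1_card big_mkcond /= big_split /=.
rewrite -step -[X in (_ + X)%N](step (fun p q => F q p)) [X in (_ + X)%N]exchange_big.
rewrite -big_split; under [RHS]eq_bigr do rewrite -big_split.
rewrite pair_bigA /=; apply: eq_bigr => -[p q] _ /=.
rewrite inE /= /adj; case: eqP => [pq|]; case: eqP => [qp|] //=; try by case: (F _ _).
by exfalso; lia.
Qed.

(* The ordered pairs of adjacent positions avoiding i - 1, i and i + 1 (for i inner). *)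
Definition outer_adj n (i : 'I_n) : {set 'I_n * 'I_n} :=
  [set w | adj w.1 w.2 &&
           [&& w.1 != i, w.2 != i, ~~ adj i w.1 & ~~ adj i w.2]].

(* The pairs (i - 1, i - 2) and (i + 1, i + 2), when in range. *)
Definition outer_path n (i : 'I_n) : {set 'I_n * 'I_n} :=
  [set w | adj w.1 w.2 && (adj i w.1 && (w.2 != i))].


Lemma sum_inner m (f : nat -> nat) :
  (\sum_(i < m.+2 | inner i) f i = \sum_(i < m) f i.+1)%N.
Proof.
rewrite big_mkcond big_ord_recl big_ord_recr /= {2}/inner /= ltnn addn0 add0n.
by apply: eq_bigr => i _; rewrite /inner /= /bump /= !add1n !ltnS ltn_ord.
Qed.

Lemma sum_ltn m k : (\sum_(p < m) (p < k) = minn m k)%N.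
Proof. by elim: m => [|m IH]; rewrite ?big_ord0 ?min0n // big_ord_recr /= IH; lia. Qed.

Lemma card_outer_adj m (i : 'I_m.+1) :
  inner i -> #|outer_adj i| = (2 * ((i - 2) + (m - i.+2)))%N.
Proof.
move=> /andP[i0 im].
rewrite (eq_card (B := [set w : 'I_m.+1 * 'I_m.+1 | adj w.1 w.2 &&
    [&& w.1 != i :> nat, w.2 != i :> nat, (i.+1 != w.1 :> nat) && (w.1.+1 != i :> nat)
      & (i.+1 != w.2 :> nat) && (w.2.+1 != i :> nat)]])); last first.
  by move=> -[p q]; rewrite !inE /adj !negb_or.
rewrite (card_adj_pairs _ (fun p q : nat => [&& p != i, q != i,
  (i.+1 != p) && (p.+1 != i) & (i.+1 != q) && (q.+1 != i)])).
(* The pair with smaller entry [p] lies left of [i - 1] when [p < i - 2], right of [i + 1] when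
   [p >= i + 2]; the factor 2 is for its orientations. *)
transitivity (\sum_(p < m) (2 * ((p < i - 2) + (1 - (p < i.+2)))))%N.
  by apply: eq_bigr => p _; lia.
rewrite -big_distrr big_split /= sum_ltn sumnB => [|p _]; last by case: ltnP.
by rewrite sum_nat_const card_ord sum_ltn; lia.
Qed.

Lemma card_outer_path m (i : 'I_m.+1) :
  #|outer_path i| = ((i.+1 < m) + (1 < i))%N.
Proof.
rewrite (eq_card (B := [set w : 'I_m.+1 * 'I_m.+1 | adj w.1 w.2 &&
    (((i.+1 == w.1 :> nat) || (w.1.+1 == i :> nat)) && (w.2 != i :> nat))])) //.
rewrite (card_adj_pairs _ (fun p q : nat => ((i.+1 == p) || (p.+1 == i)) && (q != i))).
have one k : (\sum_(p < m) (p == k :> nat) = (k < m))%N.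
  case: ltnP => [km|mk]; last by rewrite big1 // => p _; have := ltn_ord p; lia.
  rewrite (bigD1 (Ordinal km)) //= eqxx big1 // => p.
  by rewrite -val_eqE /= => /negPf ->.
have im := ltn_ord i.
(* For [i <= 1] the truncated [i - 2] is 0 and would wrongly count [p = 0]. *)
case: (ltnP 1 i) => i1.
  transitivity (\sum_(p < m) ((p == i.+1 :> nat) + (p == i - 2 :> nat)))%N.
    by apply: eq_bigr => p _; lia.
  by rewrite big_split /= !one; lia.
by rewrite -one addn0; apply: eq_bigr => p _; lia.
Qed.

Lemma sum_outer_adj n : (3 <= n)%N ->
  (\sum_(i < n | inner i) #|outer_adj i| = 2 * (n - 3) * (n - 4))%N.
Proof.
case: n => [|[|m]] // m0.
under eq_bigr => i ii do rewrite (card_outer_adj ii).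
rewrite (sum_inner _ (fun i => 2 * ((i - 2) + (m.+1 - i.+2)))%N) -big_distrr /=.
(* Reversing the order of positions turns the count on the right of [i] into the one on the left. *)
rewrite big_split /= [X in (_ + X)%N](reindex_inj rev_ord_inj) /=.
rewrite (eq_bigr (fun i : 'I_m => i - 1)%N) => [|i _]; last by lia.
rewrite [X in (_ + X)%N](eq_bigr (fun i : 'I_m => i - 1)%N) => [|i _]; last first.
  by have := ltn_ord i; lia.
have sumE k : (2 * \sum_(i < k) (i - 1) = (k - 1) * (k - 2))%N.
  by elim: k => [|k IH]; rewrite ?big_ord0 // big_ord_recr /= mulnDr IH; nia.
by rewrite !subSS -mulnA -sumE addnn -mul2n.
Qed.

Lemma sum_outer_path n : (3 <= n)%N ->
  (\sum_(i < n | inner i) #|outer_path i| = 2 * (n - 3))%N.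
Proof.
case: n => [|[|m]] // m0.
under eq_bigr do rewrite card_outer_path.
rewrite (sum_inner _ (fun i => (i.+1 < m.+1) + (1 < i))%N) big_split /=.
rewrite (eq_bigr (fun i : 'I_m => (i < m - 1) : nat)%N) => [|i _]; last by lia.
rewrite [X in (_ + X)%N](eq_bigr (fun i : 'I_m => 1 - (i < 1))%N) => [|i _]; last by lia.
by rewrite sumnB => [|i _]; [rewrite sum_nat_const card_ord !sum_ltn|case: ltnP]; lia.
Qed.

(** * Permutations with a given digit of both types at a given position *)

Lemma card_fibers (T U : finType) (S : {set T}) (D : {set U}) (f : T -> U) m :
  (forall s, s \in S -> f s \in D) ->
  (forall u, u \in D -> #|[set s in S | f s == u]| = m) ->
  (#|S| = #|D| * m)%N.
Proof.
move=> fD fm; rewrite -sum1_card (partition_big f (mem D)) //=.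
rewrite -sum_nat_const; apply: eq_bigr => u uD; rewrite -(fm u uD) -sum1_card.
by apply: eq_bigl => s; rewrite inE.
Qed.

Lemma adjC n (x y : 'I_n) : adj x y = adj y x.
Proof. by rewrite /adj orbC. Qed.

Lemma adj_neq n (x y : 'I_n) : adj x y -> x != y.
Proof. by rewrite /adj -val_eqE /=; lia. Qed.

Lemma adj_neighbours n (j i k p : 'I_n) :
  j.+1 = i -> i.+1 = k -> adj i p = (p == j) || (p == k).
Proof. by rewrite /adj -!val_eqE /=; lia. Qed.

Lemma neighbours_neq n (j i k : 'I_n) :
  j.+1 = i -> i.+1 = k -> [/\ i != j, i != k & j != k].
Proof. by move=> ji ik; split; rewrite -!val_eqE /=; lia. Qed.

Lemma in_outer_adj n (j i k p q : 'I_n) : j.+1 = i -> i.+1 = k ->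
  ((p, q) \in outer_adj i) =
  [&& adj p q, p \notin [:: i; j; k] & q \notin [:: i; j; k]].
Proof.
move=> ji ik; rewrite !inE /= !(adj_neighbours _ ji ik).
by case: (adj p q); case: (p == i); case: (q == i); case: (_ || _).
Qed.

(** The path [i], [p], [q] does not turn back, so [q] is two steps away from [i]. *)
Lemma outer_path_nadj n (i p q : 'I_n) : (p, q) \in outer_path i -> ~~ adj i q.
Proof. by rewrite inE /adj /= -!val_eqE /=; lia. Qed.

Lemma perm_eqV (T : finType) (s : {perm T}) (x y : T) : (s x == y) = ((s^-1)%g y == x).
Proof. by rewrite (canF_eq (permK s)) eq_sym. Qed.

(** The positions of [b], [c] and the values at [j], [k] can be chosen independently; together with
    [s i = a] they prescribe five distinct entries. *)
Lemma card_both_separators_disjoint n (j i k b a c : 'I_n) :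
  j.+1 = i -> i.+1 = k -> b.+1 = a -> a.+1 = c ->
  (#|[set s : 'S_n | [&& s i == a, adj (s j) (s k),
       adj ((s^-1)%g b) ((s^-1)%g c), ~~ adj i ((s^-1)%g b) & ~~ adj i ((s^-1)%g c)]]|
   = #|outer_adj i| * #|outer_adj a| * (n - 5)`!)%N.
Proof.
move=> ji ik ba ac; rewrite -cardsX.
have [ij ik' jk] := neighbours_neq ji ik; have [ab ac' bc] := neighbours_neq ba ac.
pose f (s : 'S_n) := (((s^-1)%g b, (s^-1)%g c), (s j, s k)).
apply: (card_fibers (f := f)) => [s|[[p q] [x y]]].
  rewrite inE => /and5P[/eqP si sjk sbc]; rewrite !(adj_neighbours _ ji ik).
  rewrite !negb_or -!(perm_eqV s) => /andP[bj bk] /andP[cj ck].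
  rewrite inE (in_outer_adj _ _ ji ik) (in_outer_adj _ _ ba ac) /= sjk sbc /=.
  rewrite !inE !negb_or -!(perm_eqV s) bj bk cj ck si ab ac' -si.
  by rewrite !(inj_eq perm_inj) !(eq_sym _ i) ij ik'.
rewrite inE (in_outer_adj _ _ ji ik) (in_outer_adj _ _ ba ac) /=.
move=> /andP[/and3P[pq pN qN] /and3P[xy xN yN]].
pose xs := [:: p; q; i; j; k]; pose ys := [:: b; c; a; x; y].
have -> : (n - 5 = #|'I_n| - size xs)%N by rewrite card_ord.
rewrite -(@card_perm_map _ xs ys) //; last first.
- rewrite (uniq_catC [:: b; c; a] [:: x; y]); move: xN yN (adj_neq xy).
  rewrite /= !inE !negb_or ![_ == a]eq_sym => /and3P[-> -> ->] /and3P[-> -> ->] ->.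
  by rewrite ab ac' bc.
- move: pN qN (adj_neq pq); rewrite /= !inE !negb_or.
  by rewrite ij ik' jk => /and3P[-> -> ->] /and3P[-> -> ->] ->.
apply: eq_card => s; rewrite !inE /= /f !xpair_eqE !eqseq_cons -!(perm_eqV s).
apply/idP/idP => [/andP[/and5P[-> _ _ _ _] /andP[/andP[-> ->] /andP[-> ->]]] //|].
rewrite andbT => /and5P[sp sq si /eqP sj /eqP sk].
rewrite sj sk !eqxx si sp sq.
move: sp sq; rewrite !(perm_eqV s) => /eqP-> /eqP->; rewrite xy pq.
move: pN qN; rewrite !(adj_neighbours _ ji ik) !inE !negb_or.
by move=> /and3P[_ -> ->] /and3P[_ -> ->].
Qed.

(* The element of the pair {j, k} other than p. *)
Definition other (T : eqType) (j k p : T) : T := if p == j then k else j.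

Lemma otherP n (j i k p : 'I_n) : j.+1 = i -> i.+1 = k -> adj i p ->
  p = j /\ other j k p = k \/ p = k /\ other j k p = j.
Proof.
move=> ji ik; have [_ _ jk] := neighbours_neq ji ik.
rewrite (adj_neighbours _ ji ik) /other => /orP[]/eqP->; first by left; rewrite eqxx.
by right; rewrite eq_sym (negPf jk).
Qed.

Lemma outer_path_uniq n (j i k p q : 'I_n) : j.+1 = i -> i.+1 = k ->
  (p, q) \in outer_path i -> uniq [:: i; p; other j k p; q].
Proof.
move=> ji ik pq; have := outer_path_nadj pq.
move: pq; rewrite inE /= => /and3P[pq ip qi].
have := neighbours_neq ji ik; rewrite !(adj_neighbours _ ji ik) !negb_or.
have := adj_neq pq; rewrite /= ![_ == q]eq_sym (eq_sym i p).
case: (otherP ji ik ip) => -[-> ->] qp [ij ik' jk] /andP[qj qk].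
  by rewrite (eq_sym j i) ij ik' qi jk qp qk.
by rewrite (eq_sym k i) ij ik' qi (eq_sym k) jk qp qj.
Qed.

(** Some neighbour [p] of [i] holds a value [w] next to [a]. The other value next to [a] must then
    sit at [q], beyond [p], and the other neighbour of [i] must hold [d], beyond [w]. Thus [(p, q)]
    is a path leaving [i], [(w, d)] a path leaving [a], and they prescribe four entries. *)
Lemma card_both_separators_overlap n (j i k b a c : 'I_n) :
  j.+1 = i -> i.+1 = k -> b.+1 = a -> a.+1 = c ->
  (#|[set s : 'S_n | [&& s i == a, adj (s j) (s k),
       adj ((s^-1)%g b) ((s^-1)%g c) & adj i ((s^-1)%g b) || adj i ((s^-1)%g c)]]|
   = #|outer_path i| * #|outer_path a| * (n - 4)`!)%N.
Proof.
move=> ji ik ba ac; rewrite -cardsX.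
have [ij ik' jk] := neighbours_neq ji ik; have [ab ac' bc] := neighbours_neq ba ac.
(* [g s] recovers [p], and [f s] recovers [((p, q), (w, d))]. *)
pose g (s : 'S_n) := if adj i ((s^-1)%g b) then (s^-1)%g b else (s^-1)%g c.
pose f (s : 'S_n) := ((g s, (s^-1)%g (other b c (s (g s)))), (s (g s), s (other j k (g s)))).
apply: (card_fibers (f := f)) => [s|[[p q] [w d]]].
  rewrite inE => /and4P[/eqP si sjk sbc ibc].
  have ig : adj i (g s) by rewrite /g; case: ifP ibc => // ->.
  have ag : adj a (s (g s)).
    by rewrite (adj_neighbours _ ba ac) /g; case: ifP => _; rewrite permKV eqxx ?orbT.
  have oi : s (other j k (g s)) != a.
    by rewrite -si (inj_eq perm_inj); case: (otherP ji ik ig) => -[_ ->]; rewrite eq_sym.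
  have oa : a != other b c (s (g s)) by case: (otherP ba ac ag) => -[_ ->].
  rewrite !inE /= ig ag -(perm_eqV s) si oa oi.
  rewrite !andbT; apply/andP; split.
    case: (otherP ba ac ag) => -[e ->]; first by rewrite -[X in adj X](permK s) e.
    by rewrite -[X in adj X](permK s) e adjC.
  by case: (otherP ji ik ig) => -[-> ->] //; rewrite adjC.
rewrite inE /= => /andP[pqE wdE].
pose xs := [:: i; p; other j k p; q]; pose ys := [:: a; w; d; other b c w].
have -> : (n - 4 = #|'I_n| - size xs)%N by rewrite card_ord.
rewrite -(@card_perm_map _ xs ys) ?(outer_path_uniq ji ik) //; last first.
  rewrite (perm_uniq (s2 := [:: a; w; other b c w; d])) ?(outer_path_uniq ba ac) //.
  by apply/seq.permP => P /=; lia.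
have iqN := outer_path_nadj pqE.
move: pqE wdE; rewrite !inE /= => /and3P[pq ip qi] /and3P[wd aw da].
apply: eq_card => s; rewrite !inE /= !eqseq_cons andbT /f !xpair_eqE.
apply/idP/idP => [/andP[/and4P[si _ _ _] /andP[/andP[/eqP-> /eqP<-] /andP[/eqP-> /eqP->]]]|].
  by rewrite permKV si !eqxx.
move=> /and4P[/eqP si /eqP sp /eqP so /eqP sq].
(* The test in [g] picks the right position because [p] is adjacent to [i] and [q] is not. *)
have gp : g s = p.
  rewrite /g; case: (otherP ba ac aw) => -[e1 e2].
    by rewrite -e1 -sp permK ip.
  by rewrite -e2 -sq permK (negPf iqN) -e1 -sp permK.
rewrite gp sp so -sq permK si !eqxx !andbT /=; apply/and3P; split.
- by case: (otherP ji ik ip) so sp => -[-> ->] -> -> //; rewrite adjC.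
- by case: (otherP ba ac aw) sq sp => -[-> ->] <- <-; rewrite !permK // adjC.
- by case: (otherP ba ac aw) sp => -[-> _] <-; rewrite permK ip ?orbT.
Qed.

Lemma card_both_separators n (j i k b a c : 'I_n) :
  j.+1 = i -> i.+1 = k -> b.+1 = a -> a.+1 = c ->
  (#|[set s : 'S_n | [&& s i == a, adj (s j) (s k) & adj ((s^-1)%g b) ((s^-1)%g c)]]|
   = #|outer_adj i| * #|outer_adj a| * (n - 5)`!
     + #|outer_path i| * #|outer_path a| * (n - 4)`!)%N.
Proof.
move=> ji ik ba ac; rewrite -(card_both_separators_disjoint ji ik ba ac).
rewrite -(card_both_separators_overlap ji ik ba ac) addnC.
rewrite -(cardsID [set s : 'S_n | adj i ((s^-1)%g b) || adj i ((s^-1)%g c)]).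
congr (_ + _)%N; apply: eq_card => s; rewrite !inE.
  by case: (s i == a); case: (adj (s j) _); case: (adj ((s^-1)%g b) _);
     case: (adj i _); case: (adj i _).
by case: (s i == a); case: (adj (s j) _); case: (adj ((s^-1)%g b) _);
   case: (adj i _); case: (adj i _).
Qed.

(** * Totals over all permutations: vertical, horizontal, both *)

Lemma card_vertical n (j i k : 'I_n) : j.+1 = i -> i.+1 = k ->
  (#|[set s : 'S_n | adj (s j) (s k)]| = 2 * n.-1 * (n - 2)`!)%N.
Proof.
move=> ji ik; have [_ _ jk] := neighbours_neq ji ik.
have cardD : #|[set w : 'I_n * 'I_n | adj w.1 w.2]| = (2 * n.-1)%N.
  clear; case: n => [|m]; first by apply/eqP; rewrite cards_eq0; apply/eqP/setP => -[[]].
  have := @card_adj_pairs m (fun _ _ => true); rewrite sum_nat_const card_ord mulnC => <-.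
  by apply: eq_card => w; rewrite !inE andbT.
rewrite -cardD; apply: (card_fibers (f := fun s : 'S_n => (s j, s k))) => [s|[x y]].
  by rewrite !inE.
rewrite inE /= => xy.
have -> : (n - 2 = #|'I_n| - size [:: j; k])%N by rewrite card_ord.
rewrite -(@card_perm_map _ [:: j; k] [:: x; y]) //= ?inE ?jk ?(adj_neq xy) //.
apply: eq_card => s; rewrite !inE !eqseq_cons andbT xpair_eqE.
by apply: andb_idl => /andP[/eqP-> /eqP->].
Qed.

Lemma sum_vertical n : (3 <= n)%N ->
  (\sum_(s : 'S_n) #|[set a | vertical_separator s a]| =
   (n - 2) * (2 * n.-1 * (n - 2)`!))%N.
Proof.
move=> n3.
(* Digits are reindexed by their positions, so that the sums over [s] and [i] can be exchanged. *)
transitivity (\sum_(s : 'S_n) \sum_(i < n) (vertical_separator s (s i) : nat))%N.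
  apply: eq_bigr => s _; rewrite -sum1_card big_mkcond (reindex_inj (@perm_inj _ s)).
  by apply: eq_bigr => i _; rewrite inE; case: ifP.
rewrite exchange_big /=.
transitivity (\sum_(i < n | inner i) (2 * n.-1 * (n - 2)`!))%N.
  rewrite [RHS]big_mkcond; apply: eq_bigr => i _; case: innerP => [[j [k [ji ik]]]|ii].
    rewrite -(card_vertical ji ik) -sum1_card [RHS]big_mkcond; apply: eq_bigr => s _.
    by rewrite inE (vertical_separatorE s ji ik); case: ifP.
  rewrite big1 // => s _; apply/eqP; rewrite eqb0.
  by apply: contra_notN ii => /vertical_separator_inner/innerP.
case: n n3 => [|[|m]] // _; rewrite (sum_inner _ (fun _ => _)).
by rewrite sum_nat_const card_ord subSS subSS subn0.
Qed.

(** [s^-1] maps the horizontal digits of [s] bijectively onto the vertical digits of [s^-1]; then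
    reindex by inversion. *)
Lemma sum_horizontal n :
  (\sum_(s : 'S_n) #|[set a | horizontal_separator s a]| =
   \sum_(s : 'S_n) #|[set a | vertical_separator s a]|)%N.
Proof.
rewrite [RHS](reindex_inj invg_inj); apply: eq_bigr => s _.
rewrite -(card_imset _ (@perm_inj _ s^-1)); apply: eq_card => x.
apply/imsetP/idP => [[a]|]; rewrite inE => h.
  by move=> ->; rewrite inE -horizontal_separatorV.
by exists (s x); rewrite ?permK // inE horizontal_separatorV permK.
Qed.

Lemma horizontal_separatorE n (s : 'S_n) (b a c : 'I_n) :
  b.+1 = a -> a.+1 = c -> horizontal_separator s a = adj ((s^-1)%g b) ((s^-1)%g c).
Proof.
move=> ba ac; rewrite horizontal_separatorV.
exact: vertical_separatorE.
Qed.

Lemma horizontal_separator_inner n (s : 'S_n) (a : 'I_n) :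
  horizontal_separator s a -> inner a.
Proof. by rewrite horizontal_separatorV => /vertical_separator_inner. Qed.

Lemma sum_both_separators n : (3 <= n)%N ->
  (\sum_(s : 'S_n) #|[set a | vertical_separator s a && horizontal_separator s a]| =
   4 * (n - 3) ^ 2 * (n - 3)`!)%N.
Proof.
move=> n3.
(* For given [s] and [a], only [i = s^-1 a] contributes. *)
transitivity (\sum_(i < n) \sum_(a < n) \sum_(s : 'S_n)
  ([&& s i == a, vertical_separator s a & horizontal_separator s a] : nat))%N.
  under [RHS]eq_bigr do rewrite exchange_big.
  rewrite [RHS]exchange_big; apply: eq_bigr => s _ /=.
  rewrite exchange_big -sum1_card big_mkcond; apply: eq_bigr => a _ /=.
  rewrite (bigD1 ((s^-1)%g a)) //= permKV eqxx big1 ?addn0 => [|i].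
    by rewrite inE; case: ifP.
  by rewrite eq_sym -(perm_eqV s) => /negPf ->.
transitivity (\sum_(i < n | inner i) \sum_(a < n | inner a)
  (#|outer_adj i| * #|outer_adj a| * (n - 5)`!
     + #|outer_path i| * #|outer_path a| * (n - 4)`!))%N.
  rewrite [RHS]big_mkcond; apply: eq_bigr => i _.
  case: innerP => [[j [k [ji ik]]]|ii]; last first.
    rewrite big1 // => a _; rewrite big1 // => s _; apply/eqP; rewrite eqb0.
    by apply: contra_notN ii => /and3P[/eqP <- /vertical_separator_inner/innerP].
  rewrite [RHS]big_mkcond; apply: eq_bigr => a _.
  case: innerP => [[b [c [ba ac]]]|aa]; last first.
    rewrite big1 // => s _; apply/eqP; rewrite eqb0.
    by apply: contra_notN aa => /and3P[_ _ /horizontal_separator_inner/innerP].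
  rewrite -(card_both_separators ji ik ba ac) -sum1_card [RHS]big_mkcond; apply: eq_bigr => s _.
  rewrite inE (horizontal_separatorE s ba ac).
  by case: eqP => //= <-; rewrite (vertical_separatorE s ji ik); case: ifP.
under eq_bigr do rewrite big_split -!big_distrl -!big_distrr /=.
rewrite big_split -!big_distrl /= !sum_outer_adj ?sum_outer_path //.
(* Truncated [n - 4] and [n - 5] make [n = 3] and [n = 4] separate cases; beyond them all factorials
   are multiples of [(n - 5)!]. *)
case: n n3 => [|[|[|[|[|m]]]]] // _; rewrite !subSS !subn0 !factS; lia.
Qed.

(** * Closed form of the expectation *)

Lemma sum_nb_separators n : (3 <= n)%N ->
  (\sum_(s : 'S_n) nb_separators s + 4 * (n - 3) ^ 2 * (n - 3)`! =
   4 * (n - 2) * n.-1 * (n - 2)`!)%N.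
Proof.
move=> n3; rewrite -sum_both_separators // -big_split /=.
transitivity (\sum_(s : 'S_n) (#|[set a | vertical_separator s a]| +
                               #|[set a | horizontal_separator s a]|))%N.
  (* Inclusion-exclusion for each [s], kept additive to avoid truncated subtraction. *)
  apply: eq_bigr => s _; rewrite -cardsUI; congr (_ + _)%N.
    by apply: eq_card => a; rewrite !inE.
  by apply: eq_card => a; rewrite !inE.
by rewrite big_split sum_horizontal sum_vertical //=; lia.
Qed.

Lemma expected_separatorsE (R : numFieldType) n : (3 <= n)%N ->
  expected_separators R n =
    4 * (n%:R ^+ 3 - 6 * n%:R ^+ 2 + 14 * n%:R - 13)
      / (n%:R * (n%:R - 1) * (n%:R - 2)).
Proof.
case: n => [|[|[|m]]] // n3.
rewrite /expected_separators /uniform_expectation card_Sn -natr_sum.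
have := congr1 (fun k => k%:R : R) (sum_nb_separators n3).
rewrite !subSS !subn0 !factS /= !(natrD, natrM, natrX) => /(canRL (addrK _)) ->.
have fm0 : m`!%:R != 0 :> R by rewrite pnatr_eq0 -lt0n fact_gt0.
(* With [n = m + 3], these are the denominator factors [n - 2], [n - 1], [n]; the common factor [m!]
   cancels. *)
have m0 k : m%:R + k.+1%:R != 0 :> R by rewrite -natrD pnatr_eq0 addnS.
rewrite -[m.+3]addn3 -[m.+2]addn2 -[m.+1]addn1 !natrD.
field.
have -> : m%:R + 3 - 2 = m%:R + 1 :> R by ring.
have -> : m%:R + 3 - 1 = m%:R + 2 :> R by ring.
by apply/and4P; split; [exact: (m0 0) | exact: (m0 1) | exact: (m0 2) |].
Qed.

(* The limit of the expectation *)
From mathcomp Require Import all_classical all_reals all_analysis.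
Import numFieldNormedType.Exports.
Local Open Scope classical_set_scope.

Lemma cvg_expected_separators (R : realType) :
  expected_separators R n @[n --> \oo] --> (4 : R).
Proof.
have u0 : (n%:R^-1 : R) @[n --> \oo] --> (0 : R).
  by rewrite -cvg_shiftS; exact: cvg_harmonic.
pose v n : R := n%:R^-1.
(* The closed form with numerator and denominator divided by [n ^ 3], written in [v n = 1 / n]; it
   is valid only from [n = 3] on. *)
pose h n : R := 4 * (1 - 6 * v n + 14 * (v n * v n) - 13 * (v n * v n * v n))
  / ((1 - v n) * (1 - 2 * v n)).
have hE : \forall n \near \oo, h n = expected_separators R n.
  near=> n; have n3 : (3 <= n)%N by near: n; exact: nbhs_infty_ge.
  rewrite expected_separatorsE // /h /v.
  have n0 : n%:R != 0 :> R by rewrite pnatr_eq0; lia.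
  have n1 : n%:R - 1 != 0 :> R by rewrite subr_eq0 pnatr_eq1; lia.
  have n2 : n%:R - 2 != 0 :> R by rewrite subr_eq0 eqr_nat; lia.
  by field; rewrite n0 n1 n2.
apply: cvg_trans (near_eq_cvg hE) _.
have c (x : R) : (fun _ : nat => x) @ \oo --> x by exact: cvg_cst.
(* The limit is spelled as the expression of [h] at [v = 0], so that the limit rules apply term by
   term. *)
have -> : (4 : R) = 4 * (1 - 6 * 0 + 14 * (0 * 0) - 13 * (0 * 0 * 0))
  / ((1 - 0) * (1 - 2 * 0)) by field.
apply: cvgM.
  apply: cvgM => //; apply: cvgB; last by apply: cvgM => //; do 2 apply: cvgM => //.
  apply: cvgD; last by do 2 apply: cvgM => //.
  by apply: cvgB => //; apply: cvgM.
apply: cvgV; first by rewrite !mulr0 !subr0 mulr1 oner_neq0.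
by apply: cvgM; apply: cvgB => //; apply: cvgM.
Unshelve. all: by end_near.
Qed.

Theorem theorem4p3 (R : realType) :
  (forall n : nat, (3 <= n)%N ->
    expected_separators R n =
      4 * (n%:R ^+ 3 - 6 * n%:R ^+ 2 + 14 * n%:R - 13)
        / (n%:R * (n%:R - 1) * (n%:R - 2)))
  /\ (expected_separators R n @[n --> \oo] --> (4 : R)).
Proof.
by split; [exact: expected_separatorsE | exact: cvg_expected_separators].
Qed.
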